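(* Let $X,Y$ be Banach spaces and let $u:\mathbb{R}_{\ge 0}\to\mathcal{L}(X;Y)$ be a function. Then the following are equivalent: (a) for each $x\in X$ there is $t_x\ge 0$ such that the orbit $u_x$ is smooth on $(t_x,\infty)$; (b) there is $t\ge 0$ such that for all $x\in X$ the orbit $u_x$ is smooth on $(t,\infty)$.
   Context: $X,Y$ are Banach spaces over the same field $\mathbb{R}$ or $\mathbb{C}$; $\mathcal{L}(X;Y)$ is the space of bounded linear operators from $X$ to $Y$; $\mathbb{R}_{\ge 0}=[0,\infty)$. No continuity or other regularity of $u$ is assumed. For $x\in X$, the orbit is the function $u_x:\mathbb{R}_{\ge 0}\to Y$, $u_x(t)=u(t)x$. Smooth on an open interval means infinitely often differentiable (in the norm of $Y$) on that interval. *)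

(* Defs.v *)
From HB Require Import structures.
From mathcomp Require Import all_boot all_order all_algebra.
From mathcomp Require Import all_classical all_reals all_analysis.
From mathcomp Require Import complex.
Set Implicit Arguments.
Unset Strict Implicit.
Unset Printing Implicit Defensive.
Import Order.TTheory GRing.Theory Num.Theory.
Import numFieldNormedType.Exports.
Local Open Scope classical_set_scope.
Local Open Scope ring_scope.

Variant scalar_kind := RealScalars | ComplexScalars.

Definition scalar_field (R : realType) (k : scalar_kind) : numFieldType :=
  match k with
  | RealScalars => R : numFieldType
  | ComplexScalars => R[i] : numFieldType
  end.

Definition of_real (R : realType) (k : scalar_kind) : R -> scalar_field R k :=
  match k return R -> scalar_field R k with
  | RealScalars => fun t => t
  | ComplexScalars => fun t => real_complex R t
  end.
Arguments of_real {R} k t.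

Record bounded_operator (K : numFieldType) (X Y : normedModType K) :=
  BoundedOperator {
    bounded_operator_linear :> {linear X -> Y};
    bounded_operatorP : bounded_near bounded_operator_linear (nbhs (0 : X))
  }.

Section Smooth.
Variables (R : realType) (k : scalar_kind).
Variables (Y : normedModType (scalar_field R k)).
Implicit Types f : R -> Y.

(* The library's derivable and derive1 need Y to be a normed module over R
   itself; here the real increment h acts on Y through R -> scalar_field R k. *)
Definition diff_quot f (t h : R) : Y :=
  (of_real k h)^-1 *: (f (h + t) - f t).

Definition rderivable f (t : R) : Prop := cvg (diff_quot f t @ (0 : R)^').

Definition rderive f (t : R) : Y := lim (diff_quot f t @ (0 : R)^').

(* rderive is a junk value where f is not derivable, but derivatives are local:
   on the open half-line all the iterates below are the genuine ones. *)
Definition smooth_beyond (t : R) f : Prop :=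
  forall (n : nat) (s : R), t < s -> rderivable (iter n rderive f) s.

End Smooth.

Section Orbit.
Variables (R : realType) (k : scalar_kind).
Variables (X Y : normedModType (scalar_field R k)).

Lemma nonneg_part_subproof (t : R) : 0 <= Num.max 0 t.
Proof. by rewrite le_max lexx. Qed.

Definition nonneg_part (t : R) : {nonneg R} := NngNum (nonneg_part_subproof t).

(* The orbit is extended to negative t by its value at 0; smoothness on
   ]t, +oo[ with t >= 0 does not depend on this extension. *)
Definition operator_orbit (u : {nonneg R} -> bounded_operator X Y) (x : X)
    (t : R) : Y :=
  u (nonneg_part t) x.

End Orbit.

Lemma operator_orbitE (R : realType) (k : scalar_kind)
    (X Y : normedModType (scalar_field R k))
    (u : {nonneg R} -> bounded_operator X Y) (x : X) (t : {nonneg R}) :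
  operator_orbit u x t%:num = u t x.
Proof.
rewrite /operator_orbit; congr (bounded_operator_linear (u _) x).
by apply/val_inj => /=; apply/max_idPr.
Qed.

Lemma rderivable_real (R : realType)
    (Y : normedModType (scalar_field R RealScalars))
    (f : R -> Y) (t : R) :
  rderivable f t <-> derivable (f : R -> (Y : normedModType R)) t 1.
Proof.
rewrite /rderivable /derivable.
suff <- : diff_quot f t =
    (fun h : R => h^-1 *: ((f \o shift t) (h *: (1 : R^o)) - f t)) by [].
by apply/funext => h; rewrite /diff_quot /= [h *: _]mulr1.
Qed.

Lemma rderive_real (R : realType)
    (Y : normedModType (scalar_field R RealScalars))
    (f : R -> Y) :
  rderive f = derive1 (f : R -> (Y : normedModType R)).
Proof. by []. Qed.

(* Main.v *)
From HB Require Import structures.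
Require Import Defs.
From mathcomp Require Import all_boot all_order all_algebra.
From mathcomp Require Import all_classical all_reals all_analysis.
From mathcomp Require Import complex.
Set Implicit Arguments.
Unset Strict Implicit.
Unset Printing Implicit Defensive.
Import Order.TTheory GRing.Theory Num.Theory.
Import numFieldNormedType.Exports.
Local Open Scope classical_set_scope.
Local Open Scope ring_scope.

(** Let S n be the subspace of all x whose orbit is smooth beyond n. If every
    orbit is eventually smooth, the S n cover X, so by the Baire category theorem
    one of them, S, is nonmeager. It then suffices to see that, for a fixed time
    s > n, differentiability at s of the m-th derivative of the orbit passes from
    the vectors of S to all of X.

    The subspace S need not be closed or even Borel, so that it equals X cannot be
    read off from Baire alone. The difference quotients at s are however bounded
    linear operators as long as the m-th derivative D_m(t) : x |-> u_x^(m)(t) is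
    one for each t > n. They converge pointwise on S, and two facts follow. First,
    the set of x on which the quotients with |h| < 1/(i+1) are bounded by j is
    closed; these countably many sets cover S, so one of them contains a ball and
    the quotients are uniformly bounded for small h ([uniform_bound]). Secondly,
    uniform boundedness makes the set of x on which they converge a closed
    subspace; as it contains S it has interior points, hence is X
    ([nonmeager_subspace]). The limit D_(m+1)(s) inherits linearity and the
    bound, so the argument can be iterated on m
    ([pointwise_cvg_nonmeager], [orbit_derive_bounded_linear]).

    The norm of a complex normed module takes its values in the complex numbers
    themselves, so the category arguments are carried out over a numFieldType
    in which the natural numbers are cofinal. This covers both scalar fields. *)

(** * Nonmeager sets *)

(** The order of the complex numbers is partial, so that they are not an
    archimedean real field; this is the part of the property that survives. *)
Definition nat_cofinal (K : numFieldType) :=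
  forall x : K, 0 <= x -> exists n : nat, x <= n%:R.

(** The contrapositive form of the second category condition, which hands the
    proofs below the interior point that they use. *)
Definition nonmeager (T : topologicalType) (S : set T) :=
  forall F : nat -> set T, (forall n, closed (F n)) ->
  S `<=` \bigcup_n F n -> exists n (a : T), nbhs a (F n).

Lemma scalar_field_nat_cofinal (R : realType) (k : scalar_kind) :
  nat_cofinal (scalar_field R k).
Proof.
case: k => /= x x0.
  by exists (Num.bound x); apply/ltW/archi_boundP.
exists (Num.bound (complex.Re x)).
move: x0; rewrite lecE /= => /andP[/eqP im0 re0].
have -> : x = (complex.Re x)%:C%C by case: x im0 {re0} => a b /= ->.
by rewrite -(rmorph_nat (real_complex R)) lecR; apply/ltW/archi_boundP.
Qed.

Lemma nonmeager_count (T : topologicalType) (S : set T) (I : countType)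
    (F : I -> set T) : nonmeager S -> (forall i, closed (F i)) ->
  S `<=` \bigcup_i F i -> exists i (a : T), nbhs a (F i).
Proof.
move=> nmS clF SF.
have [||n [a]] := nmS (fun n => if unpickle n is Some i then F i else set0).
- by move=> n; case: unpickle => [i|]; [exact: clF | exact: closed0].
- by move=> x /SF[i _ Fix]; exists (pickle i) => //; rewrite pickleK.
- case: unpickle => [i|] aF; first by exists i, a.
  by have := nbhs_singleton aF.
Qed.

Lemma nonmeager_bigcup (T : topologicalType) (S : nat -> set T) :
  nonmeager (\bigcup_n S n) -> exists n, nonmeager (S n).
Proof.
move=> nmS; apply: contrapT => /forallNP nomS.
have /choice[F HF] n : exists F : nat -> set T,
    [/\ forall j, closed (F j), S n `<=` \bigcup_j F j &
        forall j (a : T), ~ nbhs a (F j)].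
  have /existsNP[F /not_implyP[clF /not_implyP[SF noF]]] := nomS n.
  by exists F; split=> // j a aF; apply: noF; exists j, a.
have [||[n j] [a]] :=
  nonmeager_count (F := fun p : nat * nat => F p.1 p.2) nmS.
- by move=> [n j]; have [+ _ _] := HF n; exact.
- move=> x [n _ Snx]; have [_ /(_ _ Snx)[j _ Fx] _] := HF n.
  by exists (n, j).
- by have [_ _] := HF n; exact.
Qed.

(** * The Baire category theorem over real or complex scalars *)

Section Normed.
Variables (K : numFieldType) (archiK : nat_cofinal K).

(** One step of the nested balls construction; the radius bound d is a separate
    parameter so that the radii can be made to tend to 0. *)
Lemma baire_step (X : normedModType K) (F : set X) :
  closed F -> (forall a : X, ~ nbhs a F) ->
  forall (a : X) (r d : K), 0 < r -> 0 < d ->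
  exists p : X * K, [/\ 0 < p.2, p.2 < d, ball p.1 p.2 `<=` ball a r &
    ball p.1 p.2 `<=` ~` F].
Proof.
move=> clF noF a r d r0 d0.
have [b [bar Fb]] : exists b, ball a r b /\ ~ F b.
  apply: contrapT => /forallNP noex; apply: (noF a).
  apply/nbhs_ballP; exists r => // b bar.
  by apply: contrapT => Fb; apply: (noex b).
have /nbhs_ballP[s s0 bsV] : nbhs b (ball a r `&` ~` F).
  apply: open_nbhs_nbhs; split=> //; apply: openI; first exact: ball_open.
  by rewrite openC.
have [e [e0 ed es]] : exists e : K, [/\ 0 < e, e < d & e <= s].
  (* Half the harmonic mean lies below both numbers; a minimum is awkward for
     a partial order. *)
  exists (d * s / (d + s)); split.
  - by rewrite divr_gt0 ?mulr_gt0 ?addr_gt0.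
  - by rewrite ltr_pdivrMr ?addr_gt0// ltr_pM2l// ltrDr.
  - by rewrite ler_pdivrMr ?addr_gt0// mulrC ler_pM2l// lerDl ltW.
exists (b, e); split=> //= x /(le_ball es) /bsV[] //.
Qed.

Lemma nat_inv_lt (e : K) : 0 < e -> exists n : nat, n.+1%:R^-1 < e.
Proof.
move=> e0; have [|n nle] := @archiK e^-1; first by rewrite invr_ge0 ltW.
exists n; rewrite invf_plt ?posrE ?ltr0n//.
by apply: (le_lt_trans nle); rewrite ltr_nat.
Qed.

(** The Baire category theorem: if no F n had interior points, one could choose
    nested balls with the n.+1-st one missing F n and radii tending to 0, and the
    limit of their centers would lie in no F n. *)
Theorem nonmeager_setT (X : completeNormedModType K) : nonmeager [set: X].
Proof.
move=> F clF covF; apply: contrapT => noF.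
have noF' n (a : X) : ~ nbhs a (F n) by move=> aF; apply: noF; exists n, a.
(* Halving the radius keeps the limit of the centers inside each open ball. *)
have step (q : nat * (X * {posnum K})) : exists p : X * {posnum K},
    [/\ p.2%:num < q.1.+1%:R^-1, ball p.1 p.2%:num `<=` ball q.2.1 (q.2.2%:num / 2) &
        ball p.1 p.2%:num `<=` ~` F q.1].
  have [||[b s] /= [s0 sd sa sF]] := @baire_step _ (F q.1) (clF _) (noF' _)
    q.2.1 (q.2.2%:num / 2) q.1.+1%:R^-1.
  - exact: divr_gt0.
  - by rewrite invr_gt0 ltr0n.
  - by exists (b, PosNum s0).
have [f fP] := choice step.
pose fix p n : X * {posnum K} := if n is m.+1 then f (m, p m) else (0, PosNum (@ltr01 K)).
have nested n m : (n <= m)%N ->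
    ball (p m).1 (p m).2%:num `<=` ball (p n).1 (p n).2%:num.
  elim: m => [|m IH]; first by rewrite leqn0 => /eqP ->.
  rewrite leq_eqVlt => /orP[/eqP -> //|/IH]; apply: subset_trans.
  have [_ sub _] := fP (m, p m); apply: (subset_trans sub).
  by apply: le_ball; rewrite ler_pdivrMr// ler_peMr// ler1n.
have half n m : (n < m)%N -> ball (p n).1 ((p n).2%:num / 2) (p m).1.
  move=> nm; have [_ sub _] := fP (n, p n); apply: sub.
  by apply: (nested n.+1 m nm); exact: ballxx.
have /cvg_ex[l pl] : cvg ((fun n => (p n).1) @ \oo).
  apply/cauchy_cvgP/cauchy_exP => e /nat_inv_lt[n ne].
  exists (p n.+1).1; exists n.+1 => // m /= nm.
  have [small _ _] := fP (n, p n).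
  apply: (@le_ball _ _ _ (p n.+1).2%:num); first exact/ltW/(lt_trans small).
  by apply: (nested n.+1 m nm); exact: ballxx.
have [n _ Fl] := covF l I.
have [_ _ /(_ l)] := fP (n, p n); apply=> //.
have /cvg_ballP/(_ ((p n.+1).2%:num / 2)) := pl.
rewrite divr_gt0// => /(_ isT)[N _ HN].
pose m := maxn N n.+2.
rewrite -/(p n.+1) (splitr (p n.+1).2%:num).
apply: (@ball_triangle _ _ (p m).1); first by apply: half; rewrite leq_maxr.
by apply/ball_sym/HN; rewrite /= leq_maxl.
Qed.

(** A closed set containing a nonmeager set has an interior point a, and a
    linear subspace with an interior point absorbs every vector. *)
Lemma nonmeager_subspace (X : normedModType K) (S W : set X) :
  nonmeager S -> S `<=` W -> closed W ->
  (forall (c : K) x y, W x -> W y -> W (c *: x + y)) -> W = setT.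
Proof.
move=> nmS SW clW linW.
have [||_ [a /nbhs_ballP[r /= r0 arW]]] := nmS (fun=> W) => //.
  by move=> x /SW Wx; exists 0%N.
apply/seteqP; split=> // x _.
have Wa : W a by apply/arW/ballxx.
have W0 : W 0 by rewrite -(addNr a) -scaleN1r; exact: linW.
have [->//|x0] := eqVneq x 0.
have nx0 : 0 < `|x| by rewrite normr_gt0.
(* The scaling brings c *: x strictly inside the ball of radius r. *)
pose c : K := r / (2 * `|x|).
have c0 : 0 < c by rewrite divr_gt0// mulr_gt0.
have Wac : W (c *: x + a).
  apply: arW; rewrite -ball_normE /= opprD addrC subrK normrN normrZ gtr0_norm//.
  rewrite /c invfM mulrA mulrVK ?unitfE ?gt_eqF//.
  by rewrite ltr_pdivrMr// ltr_pMr// ltr1n.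
have Wcx : W (c *: x) by rewrite -(addrK a (c *: x)) addrC -scaleN1r; exact: linW.
rewrite -[x](@scalerK _ _ c) ?gt_eqF// -[X in W X]addr0.
exact: linW.
Qed.

(** * Pointwise limits of bounded linear maps *)

Lemma closed_norm_le (Y : normedModType K) (M : K) :
  M \is Num.real -> closed [set y : Y | `|y| <= M].
Proof.
move=> Mreal; rewrite -openC openE => y /= /negP.
rewrite -real_ltNge ?normr_real// => My.
have yid : id @ nbhs y --> y by exact: cvg_id.
apply: filterS (cvgr_norm_gt y yid _ My) => z /= Mz.
by rewrite (lt_geF Mz).
Qed.

Definition bounded_linear (X Y : normedModType K) (f : X -> Y) :=
  linear f /\ continuous f.

Lemma linear_norm_le (X Y : normedModType K) (f : X -> Y) (r M : K) :
  linear f -> 0 < r -> (forall x, `|x| < r -> `|f x| <= M) ->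
  forall x, `|f x| <= 2 * M / r * `|x|.
Proof.
move=> linf r0 fM x.
pose g : {linear X -> Y} := HB.pack f (GRing.isLinear.Build _ _ _ _ _ linf).
have [->|x0] := eqVneq x 0; first by rewrite (linear0 g : f 0 = 0) !normr0 mulr0.
have nx0 : 0 < `|x| by rewrite normr_gt0.
pose c : K := r / (2 * `|x|).
have c0 : 0 < c by rewrite divr_gt0// mulr_gt0.
have : `|f (c *: x)| <= M.
  apply: fM; rewrite normrZ gtr0_norm// /c invfM mulrA mulrVK ?unitfE ?gt_eqF//.
  by rewrite ltr_pdivrMr// ltr_pMr// ltr1n.
rewrite (linearZ_LR g c x : f (c *: x) = c *: f x) normrZ gtr0_norm// -ler_pdivlMl//.
by rewrite /c invf_div mulrAC (mulrAC 2) (mulrAC _ `|x| r^-1).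
Qed.

Lemma linear_norm_le_continuous (X Y : normedModType K) (f : X -> Y) (C : K) :
  0 <= C -> linear f -> (forall x, `|f x| <= C * `|x|) -> continuous f.
Proof.
move=> C0 linf fC.
pose g : {linear X -> Y} := HB.pack f (GRing.isLinear.Build _ _ _ _ _ linf).
apply: (@bounded_linear_continuous _ _ _ g); apply/linear_boundedP.
near=> r => x; apply: (le_trans (fC x)); apply: ler_wpM2r => //.
by near: r; apply: nbhs_pinfty_ge; exact: ger0_real.
Unshelve. all: by end_near. Qed.

Section PointwiseLimit.
Variables (X : normedModType K) (Y : completeNormedModType K).
Variables (T : Type) (G : set_system T) (FG : ProperFilter G).
Variable Q : T -> X -> Y.
(* Linearity is asked only near the limit: the difference quotients at s are
   operators only for those h with s + h still in the half-line. *)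
Hypothesis Qlin : \forall t \near G, bounded_linear (Q t).

Lemma cvg_comb (c : K) x y l m : Q^~ x @ G --> l -> Q^~ y @ G --> m ->
  Q^~ (c *: x + y) @ G --> c *: l + m.
Proof.
move=> xl ym; have : (fun t => c *: Q t x + Q t y) @ G --> c *: l + m.
  by apply: cvgD ym; apply: cvgZl_tmp.
apply: cvg_trans; apply: near_eq_cvg.
by near=> t; have [|-> //] := (near Qlin t).
Unshelve. all: by end_near. Qed.

Lemma lim_norm_le (C : K) x l : C \is Num.real ->
  (\forall t \near G, `|Q t x| <= C) -> Q^~ x @ G --> l -> `|l| <= C.
Proof.
move=> Creal QC xl.
exact: (@closed_cvg _ _ G _ (Q^~ x) _ (@closed_norm_le Y C Creal) QC l xl).
Qed.

(** Uniform boundedness from pointwise convergence on a nonmeager set only. The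
    countable basis B of the filter takes over the role of the sequence index
    of the Banach-Steinhaus theorem: x belongs to F (i, j) when the values Q t x
    are bounded by j for t in B i, and a single pair (i, j) serves a whole ball. *)
Lemma uniform_bound (S : set X) (B : nat -> set T) : nonmeager S ->
  (forall i, G (B i)) -> (forall P, G P -> exists i, B i `<=` P) ->
  (forall x, S x -> cvg (Q^~ x @ G)) ->
  exists2 C : K, 0 <= C & \forall t \near G, forall x, `|Q t x| <= C * `|x|.
Proof.
move=> nmS GB basisB Scvg.
pose good := [set t | bounded_linear (Q t)].
pose F (ij : nat * nat) := \bigcap_(t in B ij.1 `&` good)
  (Q t @^-1` [set y | `|y| <= ij.2%:R]).
have [||[i j] [a /nbhs_ballP[r /= r0 arF]]] := nonmeager_count (F := F) nmS.
- move=> [i j]; apply: closed_bigI => t [_ [_ ctQ]].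
  apply: preimage_closed; last by apply: closed_norm_le; exact: realn.
  by move=> x _; exact: ctQ.
- move=> x /Scvg/cvg_ex[l xl].
  have [M M0 QM] : exists2 M : K, 0 <= M & \forall t \near G, `|Q t x| <= M.
    exists (`|l| + 1); first by rewrite addr_ge0.
    by apply: (cvgr_norm_le l) => //; rewrite ltrDl.
  have [j Mj] := @archiK M M0; have [i BQM] := basisB _ QM.
  by exists (i, j) => // t [/BQM /= QtM _] /=; exact: le_trans Mj.
exists (2 * (j%:R + j%:R) / r).
  by rewrite divr_ge0 ?mulr_ge0 ?addr_ge0 ?ler0n// ltW.
near=> t.
have tgood : good t by exact: (near Qlin t).
have tB : B i t by near: t; exact: GB.
have [linQ _] := tgood.
apply: linear_norm_le => // x xr.
have -> : Q t x = Q t (x + a) - Q t a.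
  by rewrite -[x in x + a]scale1r linQ scale1r addrK.
apply: le_trans (ler_normB _ _) _; apply: lerD.
  apply: arF => //; rewrite -ball_normE /= opprD addrC subrK normrN//.
by apply: arF => //; exact: ballxx.
Unshelve. all: by end_near. Qed.

(** Uniform boundedness makes the convergence set closed, since Q t y is within
    C * |w - y| of Q t w; being also a subspace that contains S, it is X. *)
Theorem pointwise_cvg_nonmeager (S : set X) (B : nat -> set T) : nonmeager S ->
  (forall i, G (B i)) -> (forall P, G P -> exists i, B i `<=` P) ->
  (forall x, S x -> cvg (Q^~ x @ G)) ->
  (forall x, cvg (Q^~ x @ G)) /\
  bounded_linear (fun x => lim (Q^~ x @ G)).
Proof.
move=> nmS GB basisB Scvg.
have [C C0 QC] := uniform_bound nmS GB basisB Scvg.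
have cvgQ x : cvg (Q^~ x @ G).
  suff : [set x | cvg (Q^~ x @ G)] = setT by move/seteqP => [_ /(_ x)]; exact.
  apply: (nonmeager_subspace nmS) => //; last first.
    move=> c y z /= /cvg_ex[l yl] /cvg_ex[m zm].
    by apply/cvg_ex; exists (c *: l + m); exact: cvg_comb.
  move=> y cly; apply/cauchy_cvgP/cauchy_exP => e e0.
  have d0 : 0 < e / 2 / (C + 1) by rewrite !divr_gt0// ltr_wpDl.
  have [w [wcvg yw]] := cly _ (nbhsx_ballx y _ d0).
  move/cvg_ex: (wcvg) => [l wl]; exists l.
  change (\forall t \near G, ball l e (Q t y)); near=> t.
  have [linQ _] : bounded_linear (Q t) by exact: (near Qlin t).
  rewrite (splitr e); apply: (@ball_triangle _ _ (Q t w)).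
    by near: t; move/cvg_ballP : wl; apply; exact: divr_gt0.
  rewrite -ball_normE /=.
  have -> : Q t w - Q t y = Q t (w - y).
    by rewrite [w - y]addrC -(scaleN1r y) linQ scaleN1r addrC.
  apply: (@le_lt_trans _ _ (C * `|w - y|)); first exact: (near QC t).
  move: yw; rewrite -ball_normE /= distrC => yw.
  apply: (@le_lt_trans _ _ ((C + 1) * `|w - y|)).
    by rewrite ler_wpM2r// lerDl.
  by rewrite mulrC -ltr_pdivlMr// ltr_wpDl.
split=> //.
have lin : linear (fun x => lim (Q^~ x @ G)).
  by move=> c x y; apply: cvg_lim => //; apply: cvg_comb; exact: cvgQ.
split=> //; apply: (linear_norm_le_continuous C0 lin) => x.
apply: (lim_norm_le _ _ (cvgQ x)).
  by rewrite ger0_real// mulr_ge0.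
by near=> t; exact: (near QC t).
Unshelve. all: by end_near. Qed.

End PointwiseLimit.

End Normed.

(** * Derivatives of the orbits *)

Lemma dnbhs0_basis (R : realType) (P : set R) : (0 : R)^' P ->
  exists i : nat, [set h | h != 0 /\ `|h| < i.+1%:R^-1] `<=` P.
Proof.
move=> /nbhs_ballP[e /= e0 eP].
have [n ne] := nat_inv_lt (@scalar_field_nat_cofinal R RealScalars) e0.
exists n => h [h0 hn]; apply: eP => //.
by rewrite -ball_normE /= sub0r normrN; exact: lt_trans ne.
Qed.

(** The two conclusions are proved together because they feed each other: the
    m-th derivatives must be bounded operators on the whole half-line for the
    next difference quotients to be bounded operators near s, and only their
    pointwise convergence on all of X gives the operator of order m.+1. *)
Theorem orbit_derive_bounded_linear (R : realType) (k : scalar_kind)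
    (X Y : completeNormedModType (scalar_field R k))
    (u : {nonneg R} -> bounded_operator X Y) (S : set X) (a : R) :
  nonmeager S -> (forall x, S x -> smooth_beyond a (operator_orbit u x)) ->
  forall (m : nat) (s : R), a < s ->
  bounded_linear
    (fun x => iter m (@rderive R k Y) (operator_orbit u x) s) /\
  forall x, rderivable (iter m (@rderive R k Y) (operator_orbit u x)) s.
Proof.
move=> nmS smS.
pose D m s x := iter m (@rderive R k Y) (operator_orbit u x) s.
have step m s : a < s -> (forall t, a < t -> bounded_linear (D m t)) ->
    (forall x, rderivable (D m ^~ x) s) /\ bounded_linear (D m.+1 s).
  move=> as_ blD.
  apply: (@pointwise_cvg_nonmeager _ (@scalar_field_nat_cofinal R k) X Y R 0^' _
    (fun h x => diff_quot (D m ^~ x) s h) _ S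
    (fun i => [set h | h != 0 /\ `|h| < i.+1%:R^-1])) => //.
  - near=> h.
    have [lin1 ct1] : bounded_linear (D m (h + s)).
      apply: blD; rewrite -ltrBlDr.
      have : `|h| < s - a by near: h; apply: dnbhs0_lt; rewrite subr_gt0.
      by rewrite ltr_norml opprB => /andP[].
    have [lin2 ct2] := blD s as_.
    split=> [c x y|x].
      rewrite /diff_quot /= lin1 lin2 [c *: (_ *: _)]scalerA (mulrC c).
      by rewrite -scalerA -scalerDr (scalerBr c) opprD addrACA.
    by apply: cvgZl_tmp; apply: cvgB; [exact: ct1|exact: ct2].
  - move=> i; near=> h; split; first by near: h; exact: nbhs_dnbhs_neq.
    by near: h; apply: dnbhs0_lt; rewrite invr_gt0 ltr0n.
  - exact: dnbhs0_basis.
  - by move=> x Sx; exact: (smS x Sx m s as_).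
have blD m : forall s, a < s -> bounded_linear (D m s).
  elim: m => [s _|m IH s as_]; last by have [] := step m s as_ IH.
  pose L := u (nonneg_part s).
  split; first exact: (linearP (bounded_operator_linear L)).
  exact/(@bounded_linear_continuous _ _ _ L)/bounded_operatorP.
by move=> m s as_; split; [exact: blD | have [] := step m s as_ (blD m)].
Unshelve. all: by end_near. Qed.

Theorem proposition3p17 (R : realType) (k : scalar_kind)
    (X Y : completeNormedModType (scalar_field R k))
    (u : {nonneg R} -> bounded_operator X Y) :
  (forall x : X,
     exists2 t_x : R, 0 <= t_x & smooth_beyond t_x (operator_orbit u x))
  <->
  (exists2 t : R, 0 <= t & forall x : X, smooth_beyond t (operator_orbit u x)).
Proof.
split=> [smx|[t t0 sm] x]; last by exists t.
pose S n := [set x : X | smooth_beyond n%:R (operator_orbit u x)].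
have covS : \bigcup_n S n = setT.
  apply/seteqP; split=> // x _; have [t t0 sm] := smx x.
  exists (Num.bound t) => // m s ts; apply: sm.
  by apply: lt_trans ts; exact: archi_boundP.
have [|n nmS] := @nonmeager_bigcup X S.
  by rewrite covS; exact: (nonmeager_setT (@scalar_field_nat_cofinal R k) (X := X)).
exists n%:R => // x m s ns.
by have [_] := orbit_derive_bounded_linear nmS (fun x Sx => Sx) m ns.
Qed.
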